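(* Let $f:\mathbb R^d\to\mathbb R$ be locally Lipschitz and let $f_i:\mathbb R^d\to\mathbb R$, $i\in I$, be a family of $C^4$ functions indexed by a finite set $I$. Fix a local minimizer $\bar x$ of $f$ and suppose the set $\{\nabla f_i(\bar x)\}_{i\in I}$ is affinely independent. Suppose furthermore that $f(x)=\max_{i\in I}f_i(x)$ for all $x$ near $\bar x$. Suppose that $0\in\operatorname{ri}\partial f(\bar x)$ and that there exists $\gamma>0$ such that $f(x)-f(\bar x)\ge\frac\gamma2\|x-\bar x\|^2$ for all $x$ near $\bar x$. Then $f$ is typical at $\bar x$ (see context).
   Context: $\operatorname{ri}$ denotes relative interior. Notation: $\|\cdot\|$ is the Euclidean norm; $P_X$ is the orthogonal projection onto $X$. For locally Lipschitz $f$, $\partial f(x)$ is the Clarke subdifferential: the convex hull of all limits $\lim_i\nabla f(x_i)$ with $x_i\to x$ and $f$ differentiable at each $x_i$. Manifolds: $\mathcal M$ is a $C^p$ manifold around $\bar x$ if $\mathcal M\cap U=F^{-1}(0)$ for an open neighborhood $U$ of $\bar x$ and a $C^p$ map $F:U\to\mathbb R^m$ with surjective Jacobian; $T_{\mathcal M}(x)=\ker\nabla F(x)$. A function is $C^q$ on $\mathcal M$ near a point if it agrees on $\mathcal M$ near that point with a $C^q$ function $\hat f$ defined on an open set; the covariant gradient is $\nabla_{\mathcal M}f(x)=P_{T_{\mathcal M}(x)}(\nabla\hat f(x))$ (independent of $\hat f$). Let $0\in\partial f(\bar x)$ and $\bar x\in\mathcal M$. $\mathcal M$ is an active $C^p$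 manifold for $f$ around $\bar x$ if $\mathcal M$ is a $C^p$ manifold around $\bar x$, $f|_{\mathcal M}$ is $C^p$ near $\bar x$, and $\inf\{\|v\|:v\in\partial f(x),x\in U\setminus\mathcal M\}>0$ for some neighborhood $U$ of $\bar x$. ''$f$ is typical at $\bar x$'' means: $f$ is locally Lipschitz with local minimizer $\bar x$, and (A1) there is $\gamma>0$ with $f(x)-f(\bar x)\ge\frac\gamma2\|x-\bar x\|^2$ for all $x$ near $\bar x$; (A2) $f$ admits a $C^4$ active manifold $\mathcal M$ around $\bar x$; (A3) there is $C_{(a)}>0$ with $\|P_{T_{\mathcal M}(y)}(v-\nabla_{\mathcal M}f(y))\|\le C_{(a)}\|x-y\|$ for all $x\in\mathbb R^d$, $v\in\partial f(x)$, $y\in\mathcal M$ near $\bar x$; (A4) $f(y)\ge f(x)+\langle v,y-x\rangle+o(\|y-x\|)$ as $y\to\bar x$ within $\mathcal M$ and $x\to\bar x$ with $v\in\partial f(x)$, where $o(\cdot)$ is a univariate function with $\lim_{t\to0}o(t)/t=0$. *)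

(* Defs.v *)
From HB Require Import structures.
From mathcomp Require Import all_boot all_order all_algebra.
From mathcomp Require Import all_classical all_reals all_analysis.

Set Implicit Arguments.
Unset Strict Implicit.
Unset Printing Implicit Defensive.

Import Order.TTheory GRing.Theory Num.Theory.
Import numFieldNormedType.Exports.

Local Open Scope classical_set_scope.
Local Open Scope ring_scope.

Section Euclidean.
Context {R : realType} {d : nat}.
Implicit Types (u v x : 'rV[R]_d) (A C T : set 'rV[R]_d).

Definition dot u v : R := \sum_(i < d) u 0 i * v 0 i.

(* The library norm `|v| on row vectors is the maximum norm; it is used here
   only for the topology, differentiability and the local Lipschitz property,
   which are the same for all norms. *)
Definition enorm v : R := Num.sqrt (dot v v).

(* Meant for a linear subspace T. *)
Definition orth_proj T v : 'rV[R]_d :=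
  get [set w | T w /\ forall z, T z -> dot (v - w) z = 0].

Definition convex_hull A : set 'rV[R]_d :=
  smallest (fun C : set (convex_lmodType 'rV[R]_d) => convex_set C) A.

Definition affine_set A : Prop :=
  forall u v (t : R), A u -> A v -> A ((1 - t) *: u + t *: v).

Definition affine_hull A : set 'rV[R]_d := smallest affine_set A.

Definition relint C : set 'rV[R]_d :=
  [set x | C x /\ \forall y \near x, affine_hull C y -> C y].

Definition affinely_independent (I : finType) (g : I -> 'rV[R]_d) : Prop :=
  forall c : I -> R, \sum_i c i = 0 -> \sum_i c i *: g i = 0 ->
  forall i, c i = 0.

End Euclidean.

Section Smooth.
Context {R : realType} {d : nat}.
Implicit Types (f : 'rV[R]_d -> R) (x xbar : 'rV[R]_d) (U : set 'rV[R]_d).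

Definition grad f x : 'rV[R]_d := \row_(i < d) 'd f x (delta_mx 0 i).

(* f is C^p on the open set U *)
Fixpoint Ck (p : nat) U f : Prop :=
  if p is q.+1 then
    (forall x, U x -> differentiable f x) /\
    (forall i, Ck q U (fun x => grad f x 0 i))
  else forall x, U x -> {for x, continuous f}.

Definition locally_lipschitz f : Prop :=
  forall x, exists2 U, nbhs x U & [lipschitz f z | z in U].

Definition local_minimizer f x : Prop := \forall z \near x, f x <= f z.

Definition quadratic_growth (gamma : R) f x : Prop :=
  \forall z \near x, gamma / 2 * enorm (z - x) ^+ 2 <= f z - f x.

Definition limiting_gradients f x : set 'rV[R]_d :=
  [set g | exists u : nat -> 'rV[R]_d,
    [/\ u @ \oo --> x,
        forall k, differentiable f (u k) &
        (fun k => grad f (u k)) @ \oo --> g]].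

Definition clarke f x : set 'rV[R]_d := convex_hull (limiting_gradients f x).

End Smooth.

Section Manifold.
Context {R : realType} {d : nat}.
Implicit Types (f : 'rV[R]_d -> R) (x v xbar : 'rV[R]_d) (M U : set 'rV[R]_d).

(* The C^p map F on U cuts out M near x.  The jacobian acts on row vectors by
   v *m 'J F z, so that row_full expresses its surjectivity onto R^m. *)
Definition local_equation (p m : nat) M x U (F : 'rV[R]_d -> 'rV[R]_m) : Prop :=
  [/\ open U, U x,
      forall j, Ck p U (fun z => F z 0 j),
      forall z, U z -> row_full ('J F z) &
      M `&` U = U `&` F @^-1` [set 0]].

Definition manifold_around (p : nat) M x : Prop :=
  exists (m : nat) U (F : 'rV[R]_d -> 'rV[R]_m), local_equation p M x U F.

(* For x in M, all C^1 local equations around x have the same kernel at x, so the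
   existential quantifier does not enlarge the tangent space; for the same
   reason p = 1 also covers the local equations of higher smoothness. *)
Definition tangent_space M x : set 'rV[R]_d :=
  [set v | exists (m : nat) U (F : 'rV[R]_d -> 'rV[R]_m),
    local_equation 1 M x U F /\ v *m 'J F x = 0].

Definition smooth_extension (q : nat) f M x (fhat : 'rV[R]_d -> R) : Prop :=
  exists U, [/\ open U, U x, Ck q U fhat & forall z, M z -> U z -> f z = fhat z].

Definition smooth_on (q : nat) f M x : Prop :=
  exists fhat, smooth_extension q f M x fhat.

(* The projected gradient is the same for all smooth extensions of f. *)
Definition covariant_grad f M x : 'rV[R]_d :=
  get [set g | exists2 fhat, smooth_extension 1 f M x fhat &
                             g = orth_proj (tangent_space M x) (grad fhat x)].

Definition active_manifold (p : nat) f M x : Prop :=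
  [/\ M x, clarke f x 0, manifold_around p M x, smooth_on p f M x &
      exists2 U, nbhs x U &
        (0 < ereal_inf [set (enorm v)%:E | v in
                         \bigcup_(z in U `\` M) clarke f z])%E].

Definition tangent_gradient_bound f M xbar : Prop :=
  exists2 C : R, 0 < C &
    \forall x \near xbar & y \near xbar, M y ->
      forall v, clarke f x v ->
      enorm (orth_proj (tangent_space M y) (v - covariant_grad f M y))
        <= C * enorm (x - y).

Definition lower_expansion f M xbar : Prop :=
  exists2 o : R -> R, o t / t @[t --> 0^'] --> 0 &
    \forall y \near xbar & x \near xbar, M y ->
      forall v, clarke f x v ->
      f x + dot v (y - x) + o (enorm (y - x)) <= f y.

Definition typical f xbar : Prop :=
  [/\ locally_lipschitz f, local_minimizer f xbar,
      exists2 gamma : R, 0 < gamma & quadratic_growth gamma f xbar &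
      exists M, [/\ active_manifold 4 f M xbar,
                    tangent_gradient_bound f M xbar &
                    lower_expansion f M xbar]].

End Manifold.

(* Main.v *)
(* Let J be the set of indices active at xbar.  The active manifold is
   M = {x | f_i x = f_j x for all i, j in J}: affine independence of the
   gradients makes its equations regular.  Near any x, a Clarke subgradient of f
   is a convex combination of the gradients of the pieces active at x.  Testing
   directions dual to the affinely independent gradients shows that every
   active gradient is a limiting gradient at xbar, hence 0 in ri gives a
   positive multiplier mu_i to each i in J; off M some i in J is inactive, and the
   direction dual to i then bounds subgradients away from 0 by about mu_i.  On M the
   gradients of the pieces in J have the same tangential part, so both remaining
   bounds reduce to the Lipschitz continuity of these gradients.  That tangent
   vectors do not depend on the chosen local equation is Lyusternik's theorem,
   obtained from Banach's fixed point theorem. *)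
From HB Require Import structures.
Require Import Defs.
From mathcomp Require Import all_boot all_order all_algebra.
From mathcomp Require Import all_classical all_reals all_analysis.
From mathcomp Require Import ring lra.

Set Implicit Arguments.
Unset Strict Implicit.
Unset Printing Implicit Defensive.

Import Order.TTheory GRing.Theory Num.Theory.
Import numFieldNormedType.Exports.

Local Open Scope classical_set_scope.
Local Open Scope ring_scope.

(** * Euclidean structure and convex combinations *)

Lemma cvg_sumr {R : realType} (T : Type) (F : set_system T) {FF : Filter F} n
    (u : 'I_n -> T -> R) (l : 'I_n -> R) : (forall i, u i @ F --> l i) ->
  (fun x => \sum_i u i x) @ F --> \sum_i l i.
Proof.
move=> ul; rewrite (_ : (fun x => _) = \sum_i u i); last first.
  by apply/funext => x; rewrite fct_sumE.
elim/big_ind2: _ => [|f a h b fa hb|i _]; first exact: cvg_cst.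
  exact: cvgD.
exact: ul.
Qed.

Section Dot.
Context {R : realType} {d : nat}.
Implicit Types (u v w : 'rV[R]_d) (a : R).

Lemma dotC u v : dot u v = dot v u.
Proof. by apply: eq_bigr => i _; rewrite mulrC. Qed.

Lemma dotDl u v w : dot (u + v) w = dot u w + dot v w.
Proof. by rewrite -big_split; apply: eq_bigr => i _; rewrite mxE mulrDl. Qed.

Lemma dotZl a u v : dot (a *: u) v = a * dot u v.
Proof. by rewrite mulr_sumr; apply: eq_bigr => i _; rewrite mxE mulrA. Qed.

Lemma dotNl u v : dot (- u) v = - dot u v.
Proof. by rewrite -scaleN1r dotZl mulN1r. Qed.

Lemma dotBl u v w : dot (u - v) w = dot u w - dot v w.
Proof. by rewrite dotDl dotNl. Qed.

Lemma dot0l u : dot 0 u = 0.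
Proof. by rewrite -(scale0r 0) dotZl mul0r. Qed.

Lemma dotDr u v w : dot u (v + w) = dot u v + dot u w.
Proof. by rewrite !(dotC u) dotDl. Qed.

Lemma dotZr a u v : dot u (a *: v) = a * dot u v.
Proof. by rewrite !(dotC u) dotZl. Qed.

Lemma dotNr u v : dot u (- v) = - dot u v.
Proof. by rewrite !(dotC u) dotNl. Qed.

Lemma dotBr u v w : dot u (v - w) = dot u v - dot u w.
Proof. by rewrite dotDr dotNr. Qed.

Lemma dot_suml (I : finType) (g : I -> 'rV[R]_d) u :
  dot (\sum_i g i) u = \sum_i dot (g i) u.
Proof. by elim/big_ind2: _ => [|? x ? y <- <-|//]; rewrite ?dot0l ?dotDl. Qed.

Lemma dot_mul u v : dot u v = (u *m v^T) 0 0.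
Proof. by rewrite mxE; apply: eq_bigr => i _; rewrite mxE. Qed.

Lemma dot_ge0 u : 0 <= dot u u.
Proof. by apply: sumr_ge0 => i _; rewrite -expr2 sqr_ge0. Qed.

Lemma dot_eq0 u : dot u u = 0 -> u = 0.
Proof.
move/eqP; rewrite psumr_eq0 => [/allP u0|i _]; last by rewrite -expr2 sqr_ge0.
apply/rowP => i; rewrite mxE; apply/eqP.
by have := u0 i (mem_index_enum i); rewrite -expr2 sqrf_eq0.
Qed.

Lemma enorm_ge0 u : 0 <= enorm u. Proof. exact: sqrtr_ge0. Qed.

Lemma enorm_sqr u : enorm u ^+ 2 = dot u u.
Proof. by rewrite sqr_sqrtr ?dot_ge0. Qed.

(** Cauchy-Schwarz: the squared norm of [dot v v *: u - dot u v *: v] is nonnegative and factors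
    through [dot v v]. *)
Lemma dot_sqr_le u v : dot u v ^+ 2 <= dot u u * dot v v.
Proof.
have [v0|v0] := eqVneq (dot v v) 0.
  by rewrite (dot_eq0 v0) dotC !dot0l expr0n mulr0.
have vp : 0 < dot v v by rewrite lt_neqAle eq_sym v0 dot_ge0.
have := dot_ge0 (dot v v *: u - dot u v *: v).
rewrite dotBl !dotBr !dotZl !dotZr (dotC v u).
set a := dot u u; set b := dot u v; set c := dot v v.
rewrite (_ : _ - _ = c * (a * c - b ^+ 2)); last by ring.
by rewrite pmulr_rge0 // subr_ge0.
Qed.

Lemma dot_le_enorm u v : dot u v <= enorm u * enorm v.
Proof.
apply: le_trans (ler_norm _) _.
rewrite -ler_sqr ?nnegrE ?mulr_ge0 ?enorm_ge0 //.
by rewrite exprMn !enorm_sqr real_normK ?num_real // dot_sqr_le.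
Qed.

Lemma coord_le_norm v i : `|v 0 i| <= `|v|.
Proof.
have /mapP[j _ ->] : `|v 0 i| \in [seq `|v x.1 x.2| | x : 'I_1 * 'I_d].
  by apply/mapP; exists (ord0, i) => //=; rewrite mem_enum.
by rewrite [`|v|]mx_normrE; apply: le_bigmax.
Qed.

Lemma norm_le_coord v a : 0 <= a -> (forall i, `|v 0 i| <= a) -> `|v| <= a.
Proof.
move=> a0 va; rewrite [`|v|]mx_normrE; apply/bigmax_leP; split=> // -[i j] _.
by rewrite /= ord1.
Qed.

Lemma norm_le_enorm v : `|v| <= enorm v.
Proof.
apply: norm_le_coord => [|i]; first exact: enorm_ge0.
rewrite -ler_sqr ?nnegrE ?enorm_ge0 // enorm_sqr real_normK ?num_real //.
rewrite /dot (bigD1 i) //= -expr2 lerDl.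
by apply: sumr_ge0 => j _; rewrite -expr2 sqr_ge0.
Qed.

Lemma abs_dot_le u v : `|dot u v| <= d%:R * `|u| * `|v|.
Proof.
apply: le_trans (ler_norm_sum _ _ _) _.
have -> : d%:R * `|u| * `|v| = \sum_(i < d) (`|u| * `|v|).
  by rewrite sumr_const card_ord -mulrA mulr_natl.
by apply: ler_sum => i _; rewrite normrM ler_pM // coord_le_norm.
Qed.

Lemma enorm_le_norm v : enorm v <= d%:R * `|v|.
Proof.
rewrite -ler_sqr ?nnegrE ?enorm_ge0 ?mulr_ge0 // enorm_sqr.
apply: le_trans (ler_norm _) _; apply: le_trans (abs_dot_le _ _) _.
rewrite exprMn -mulrA -expr2 ler_wpM2r ?sqr_ge0 //.
by rewrite -natrX ler_nat; case: (d) => // n; rewrite leq_pmulr.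
Qed.

Lemma dot_delta u i : dot u (delta_mx 0 i) = u 0 i.
Proof.
rewrite /dot (bigD1 i) //= big1; first by rewrite mxE !eqxx mulr1 addr0.
by move=> j ji; rewrite mxE (negPf ji) andbF mulr0.
Qed.

Lemma dotl_continuous w : continuous (fun u => dot u w).
Proof.
move=> u; apply: (@cvg_sumr _ _ (nbhs u) (nbhs_filter u)) => i.
by apply: cvgMr_tmp; exact: coord_continuous.
Qed.

Section Combination.
Context {I : finType}.
Variable lam : I -> R.
Hypothesis lam1 : \sum_i lam i = 1.

(** Since the weights sum to 1, the vectors [b i] can be traded for the single vector [c] as soon as
    they all have the same component along [w]. It serves to compare gradients of different pieces
    along a tangent vector. *)
Lemma dot_combinationB (a b : I -> 'rV[R]_d) c w :
  (forall i, lam i != 0 -> dot (b i - c) w = 0) ->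
  dot (\sum_i lam i *: (a i - b i)) w = dot (\sum_i lam i *: a i) w - dot c w.
Proof.
move=> bc; rewrite !dot_suml -[X in _ - X]mul1r -[X in X * _]lam1 mulr_suml -sumrB.
apply: eq_bigr => i _; rewrite !dotZl dotBl mulrBr; congr (_ - _).
have [->|/bc] := eqVneq (lam i) 0; first by rewrite !mul0r.
by rewrite dotBl => /subr0_eq ->.
Qed.

Lemma dot_combination_le (b : I -> 'rV[R]_d) z (r : R) :
  (forall i, 0 <= lam i) -> (forall i, lam i != 0 -> dot (b i) z <= r) ->
  dot (\sum_i lam i *: b i) z <= r.
Proof.
move=> lam0 br; rewrite dot_suml -[leRHS]mul1r -[X in X * _]lam1 mulr_suml.
apply: ler_sum => i _; rewrite dotZl.
by have [->|/br bri] := eqVneq (lam i) 0; [rewrite !mul0r | rewrite ler_wpM2l].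
Qed.

End Combination.

End Dot.

(** * Differential calculus *)

Section Differential.
Context {R : realType} {d : nat}.
Implicit Types (f : 'rV[R]_d -> R) (x y v : 'rV[R]_d) (U : set 'rV[R]_d).

Lemma diff_grad f x v : 'd f x v = dot (grad f x) v.
Proof.
rewrite {1}(row_sum_delta v) linear_sum /=; apply: eq_bigr => i _.
by rewrite linearZ /= mxE mulrC.
Qed.

Lemma gradB f g x : differentiable f x -> differentiable g x ->
  grad (fun z => f z - g z) x = grad f x - grad g x.
Proof.
move=> df dg; apply/rowP => i; rewrite !mxE.
by rewrite (_ : (fun z => _) = f - g) // diffB.
Qed.

(** The one-variable mean value theorem applied to [f] along the segment from [x] to [y]. *)
Lemma mean_value f x y :
  (forall t : R, 0 <= t <= 1 -> differentiable f (x + t *: (y - x))) ->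
  exists2 t : R, 0 <= t <= 1 &
    f y - f x = dot (grad f (x + t *: (y - x))) (y - x).
Proof.
move=> df; pose g (t : R) := x + t *: (y - x).
have dg (t : R) : is_diff t g ( *:%R ^~ (y - x)).
  rewrite (_ : *:%R ^~ _ = 0 + *:%R ^~ (y - x)); last by rewrite add0r.
  exact: is_diffD.
have dfg (t : R) : 0 <= t <= 1 -> differentiable (f \o g) t.
  by move=> t01; apply: differentiable_comp; [exact: ex_diff | exact: df].
have dfgE (t : R) : t \in `]0, 1[%R ->
    is_derive t 1 (f \o g) (dot (grad f (g t)) (y - x)).
  rewrite in_itv /= => /andP[t0 t1].
  have t01 : 0 <= t <= 1 by rewrite !ltW.
  apply: DeriveDef; first exact/diff_derivable/dfg.
  rewrite deriveE; last exact: dfg.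
  rewrite diff_comp /=; [|exact: ex_diff|exact: df].
  by rewrite (@diff_val _ _ _ _ _ _ _ (dg t)) scale1r diff_grad.
have cfg : {within `[0, 1], continuous (f \o g)}.
  apply: continuous_in_subspaceT => t; rewrite inE /= in_itv /= => t01.
  exact/differentiable_continuous/dfg.
have [t t01] := MVT_segment ler01 dfgE cfg.
rewrite /= /g scale1r scale0r subr0 mulr1 addr0 [x + (y - x)]addrC subrK => fg.
by exists t => //; move: t01; rewrite in_itv.
Qed.

Lemma ball_segment z (r : R) x y (t : R) : 0 <= t <= 1 -> ball z r x -> ball z r y ->
  ball z r (x + t *: (y - x)).
Proof.
rewrite -ball_normE /= => /andP[t0 t1] zx zy.
rewrite (_ : z - _ = (1 - t) *: (z - x) + t *: (z - y)); last first.
  by apply/rowP => i; rewrite !mxE; ring.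
apply: le_lt_trans (ler_normD _ _) _; rewrite !normrZ !ger0_norm ?subr_ge0 //.
move: (`|z - x|) (`|z - y|) zx zy => a b ar br.
by case: (leP a b) => ab; nra.
Qed.

Lemma mean_value_ball U f z (r : R) x y : ball z r `<=` U ->
  (forall p, U p -> differentiable f p) -> ball z r x -> ball z r y ->
  exists t : R, [/\ 0 <= t <= 1, ball z r (x + t *: (y - x)) &
    f y - f x = dot (grad f (x + t *: (y - x))) (y - x)].
Proof.
move=> rU df zx zy.
have [t t01|t t01 fxy] := @mean_value f x y; first exact/df/rU/ball_segment.
by exists t; split=> //; exact: ball_segment.
Qed.

Lemma Ck_differentiable p U f x : Ck p.+1 U f -> U x -> differentiable f x.
Proof. by case=> + _; apply. Qed.

Lemma CkS p U f : Ck p.+1 U f -> Ck p U f.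
Proof.
elim: p f => [|p ihp] f [df cf]; first by move=> x /df/differentiable_continuous.
by split=> // i; exact: ihp.
Qed.

Lemma Ck_le p q U f : (p <= q)%N -> Ck q U f -> Ck p U f.
Proof. by move/subnK <-; elim: (q - p)%N => // n ih /CkS. Qed.

Lemma Ck_sub p U V f : V `<=` U -> Ck p U f -> Ck p V f.
Proof.
move=> VU; elim: p f => [|p ihp] f /=; first by move=> cf x /VU/cf.
by move=> [df cf]; split=> [x /VU/df//|i]; exact: ihp.
Qed.

Lemma grad_continuous U f x : open U -> U x -> Ck 1 U f ->
  {for x, continuous (grad f)}.
Proof.
move=> oU Ux [_ cf]; apply/(@cvgrPdist_le _ _ _ (nbhs x) (nbhs_filter x)) => e e0.
have H : \forall z \near x, forall i, `|grad f x 0 i - grad f z 0 i| <= e.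
  apply: (@filter_forall _ _ _ (nbhs x) (nbhs_filter x)) => i.
  by have /cvgrPdist_le := cf i x Ux; apply.
apply: filterS H => z Hz; apply: norm_le_coord => [|i]; first exact: ltW.
by rewrite mxE [X in _ + X]mxE.
Qed.

(** Strict differentiability: both endpoints vary near [y] while the gradient stays frozen at [y].
    It follows from the mean value theorem and the continuity of the gradient, and it is what makes
    the map in Lyusternik's theorem a contraction. *)
Lemma C1_strict_diff U f y (e : R) : open U -> U y -> Ck 1 U f -> 0 < e ->
  exists2 r, 0 < r & forall p q, ball y r p -> ball y r q ->
    `|f q - f p - dot (grad f y) (q - p)| <= e * `|q - p|.
Proof.
move=> oU Uy cf e0.
have d1 : 0 < d%:R + 1 :> R by rewrite ltr_wpDl.
(* The division absorbs the factor [d%:R] of [abs_dot_le]; adding 1 keeps the divisor positive when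
   [d = 0]. *)
have ed : 0 < e / (d%:R + 1) by rewrite divr_gt0.
have := grad_continuous oU Uy cf; move=> /cvgrPdist_le /(_ _ ed) H.
have [r r0 rU] : nbhs_ball y
    [set z | U z /\ `|grad f y - grad f z| <= e / (d%:R + 1)].
  by apply/nbhs_ballP; apply: filterI => //; exact: open_nbhs_nbhs.
exists r => // p q yp yq.
have dW z : U z /\ `|grad f y - grad f z| <= e / (d%:R + 1) ->
    differentiable f z.
  by case=> Uz _; exact: Ck_differentiable cf Uz.
have [t [_ /rU[_ gt] ->]] := mean_value_ball rU dW yp yq.
rewrite -dotBl; rewrite distrC in gt.
apply: le_trans (abs_dot_le _ _) _; rewrite ler_wpM2r //.
apply: le_trans (ler_wpM2l _ gt) _ => //.
by rewrite mulrCA ler_piMr ?(ltW e0) // ler_pdivrMr // mul1r lerDl.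
Qed.

Lemma C1_locally_lipschitz U f y : open U -> U y -> Ck 1 U f ->
  exists2 L, 0 < L & \forall p \near y & q \near y, `|f q - f p| <= L * `|q - p|.
Proof.
move=> oU Uy cf; have [r r0 H] := C1_strict_diff oU Uy cf ltr01.
exists (d%:R * `|grad f y| + 1); first by rewrite ltr_wpDl.
exists (ball y r, ball y r); first by split; exact: nbhsx_ballx.
move=> [p q] [/= yp yq]; have {H} := H p q yp yq.
rewrite mul1r => H; rewrite mulrDl mul1r.
rewrite -[f q - f p](subrK (dot (grad f y) (q - p))) addrC.
by apply: le_trans (ler_normD _ _) _; rewrite lerD // abs_dot_le.
Qed.

Lemma C2_grad_lipschitz U f y : open U -> U y -> Ck 2 U f ->
  exists2 L, 0 < L &
    \forall p \near y & q \near y, `|grad f q - grad f p| <= L * `|q - p|.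
Proof.
move=> oU Uy [_ cf].
have /boolp.choice[L HL] : forall i, exists L, 0 < L /\
    \forall p \near y & q \near y,
      `|grad f q 0 i - grad f p 0 i| <= L * `|q - p|.
  by move=> i; have [L L0 HL] := C1_locally_lipschitz oU Uy (cf i); exists L.
exists (1 + \sum_i L i).
  by rewrite ltr_wpDr // sumr_ge0 // => i _; case: (HL i) => /ltW.
have H : \forall p \near y & q \near y, forall i,
    `|grad f q 0 i - grad f p 0 i| <= L i * `|q - p|.
  apply: (@filter_forall _ _ _ _ (filter_prod_filter (nbhs_filter y) (nbhs_filter y))) => i.
  by case: (HL i).
apply: filterS H => -[p q] /= H; apply: norm_le_coord => [|i].
  by rewrite mulr_ge0 // addr_ge0 // sumr_ge0 // => i _; case: (HL i) => /ltW.
rewrite mxE [X in _ + X]mxE; apply: le_trans (H i) _; rewrite ler_wpM2r //.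
rewrite (bigD1 i) //= addrCA lerDl addr_ge0 // sumr_ge0 // => j _.
by case: (HL j) => /ltW.
Qed.

End Differential.

(** * Banach's fixed point theorem on a closed ball *)

Section FixedPoint.
Context {R : realType} {m : nat}.

Lemma contraction_fixed_point (phi : 'rV[R]_m -> 'rV[R]_m) (rho : R) :
  0 <= rho -> (forall w, `|w| <= rho -> `|phi w| <= rho) ->
  (forall w w', `|w| <= rho -> `|w'| <= rho ->
     `|phi w - phi w'| <= 2^-1 * `|w - w'|) ->
  exists2 w, `|w| <= rho & phi w = w.
Proof.
move=> rho0 phiB phiL.
pose X : completeNormedModType R := HB.pack 'rV[R]_m.
pose B : set X := [set w | `|w| <= rho].
have BB : {homo (phi : X -> X) : x / B x >-> B x} by move=> w; exact: phiB.
pose F : {fun B >-> B} := mkfun_fun BB.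
have ctrF : is_contraction F.
  exists 2^-1%:nng; split=> /=; first by rewrite invf_lt1 ?ltr1n.
  by move=> [w w'] [/= wB w'B]; exact: phiL.
have clB : closed B.
  apply: (@closed_comp X R Num.norm [set r | r <= rho]); last exact: closed_le.
  by move=> w _; exact: norm_continuous.
have B0 : B !=set0 by exists 0; rewrite /B /= normr0.
by have [w wB wE] := banach_fixed_point ctrF clB B0; exists w.
Qed.

End FixedPoint.

(** * Vector-valued maps and their jacobians *)

Section VectorValued.
Context {R : realType} {d m : nat}.
Implicit Types (G : 'rV[R]_d -> 'rV[R]_m) (y v : 'rV[R]_d).

Lemma differentiable_row G y :
  (forall j, differentiable (fun z => G z 0 j) y) -> differentiable G y.
Proof.
move=> dG.
rewrite (_ : G = \sum_j (fun z => G z 0 j *: delta_mx 0 j)); last first.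
  by apply/funext => z; rewrite fct_sumE -row_sum_delta.
by apply: differentiable_sum => j; exact: differentiableZl.
Qed.

Lemma mul_jacobian G y v : (forall j, differentiable (fun z => G z 0 j) y) ->
  v *m 'J G y = \row_j dot (grad (fun z => G z 0 j) y) v.
Proof.
move=> dG; have dGy := differentiable_row dG.
rewrite -deriveEjacobian // derive_mx; last exact: diff_derivable.
by apply/rowP => j; rewrite !mxE deriveE // diff_grad.
Qed.

Lemma mulmx_norm_le (B : 'M[R]_(m, d)) (w : 'rV[R]_m) :
  `|w *m B| <= (\sum_i \sum_j `|B i j|) * `|w|.
Proof.
apply: norm_le_coord => [|j].
  by rewrite mulr_ge0 // sumr_ge0 // => i _; rewrite sumr_ge0.
rewrite mxE; apply: le_trans (ler_norm_sum _ _ _) _.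
rewrite mulr_suml; apply: ler_sum => i _.
rewrite normrM mulrC ler_pM ?coord_le_norm // (bigD1 j) //= lerDl.
by rewrite sumr_ge0.
Qed.

Lemma C1_row_strict_diff (U : set 'rV[R]_d) G y (e : R) : open U -> U y ->
  (forall j, Ck 1 U (fun z => G z 0 j)) -> 0 < e ->
  exists2 r, 0 < r & forall p q, ball y r p -> ball y r q ->
    `|G q - G p - (q - p) *m 'J G y| <= e * `|q - p|.
Proof.
move=> oU Uy cG e0.
have /boolp.choice[r Hr] : forall j, exists r, 0 < r /\ forall p q,
    ball y r p -> ball y r q ->
    `|G q 0 j - G p 0 j - dot (grad (fun z => G z 0 j) y) (q - p)|
      <= e * `|q - p|.
  by move=> j; have [r r0 rG] := C1_strict_diff oU Uy (cG j) e0; exists r.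
(* The seed 1 of the minimum gives a positive radius even when [m = 0]. *)
exists (\big[Num.min/1]_j r j).
  by apply/bigmin_gtP; split=> // j _; case: (Hr j).
move=> p q yp yq; apply: norm_le_coord => [|j]; first by rewrite mulr_ge0 // ltW.
rewrite mul_jacobian; last by move=> i; exact: Ck_differentiable (cG i) Uy.
have rj : ball y (\big[Num.min/1]_j r j) `<=` ball y (r j).
  by apply: le_ball; exact: bigmin_le.
rewrite !mxE; exact: ((Hr j).2 _ _ (rj _ yp) (rj _ yq)).
Qed.

End VectorValued.

(** * Tangent vectors *)

Section Tangent.
Context {R : realType} {d : nat}.
Implicit Types (y v : 'rV[R]_d) (M U V : set 'rV[R]_d).

Lemma nbhs_ball_sub V y (r0 : R) : open V -> V y -> 0 < r0 ->
  exists r, [/\ 0 < r, r <= r0 & ball y r `<=` V].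
Proof.
move=> oV Vy r00.
have [r r_gt0 rV] : nbhs_ball y V by apply/nbhs_ballP; exact: open_nbhs_nbhs.
exists (Num.min r r0); split; first by rewrite lt_min r00 r_gt0.
  by rewrite ge_min lexx orbT.
by apply: subset_trans rV; apply: le_ball; rewrite ge_min lexx.
Qed.

(* Lyusternik's theorem: the correction of y + t v is the fixed point of
   w |-> w - G (y + t v + w B), where B is a right inverse of the derivative. *)
Lemma local_equation_tangent m M U (G : 'rV[R]_d -> 'rV[R]_m) y v (e : R) :
  local_equation 1 M y U G -> M y -> v *m 'J G y = 0 -> 0 < e <= 1 ->
  exists2 r, 0 < r & forall t, `|t| < r ->
    exists2 p, M p & `|p - (y + t *: v)| <= e * `|t|.
Proof.
move=> [oU Uy cG fullG MU] My vG /andP[e0 e1].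
have Gy : G y = 0.
  by have : (M `&` U) y by []; rewrite MU => -[].
have [B BA] := row_fullP (fullG y Uy).
set K := (\sum_i \sum_j `|B i j|) + 1.
have K0 : 0 < K.
  by rewrite ltr_wpDl // sumr_ge0 // => i _; rewrite sumr_ge0.
have KB (w : 'rV[R]_m) : `|w *m B| <= K * `|w|.
  apply: le_trans (mulmx_norm_le B w) _.
  by rewrite ler_wpM2r // lerDl.
set n := `|v| + 1.
have n0 : 0 < n by rewrite ltr_wpDl.
(* Chosen so that [e' * K * n = e / 2]. This gives both the contraction factor [e' * K <= 1/2] and
   the size [K * rho <= e * |t|] of the correction. *)
set e' := e / (2 * K * n).
have e'0 : 0 < e' by rewrite divr_gt0 // !mulr_gt0.
have e'K : e' * K * n = e / 2 by rewrite /e'; field; rewrite !gt_eqF.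
have [r1 r10 H1] := C1_row_strict_diff oU Uy cG e'0.
have [r [r0 rr1 rU]] := nbhs_ball_sub oU Uy r10.
(* The displacement [t *: v + w *m B] has norm at most [|t| * |v| + |t|], that is [|t| * n], which
   must stay below [r]. *)
exists (r / n) => [|t]; first by rewrite divr_gt0.
rewrite ltr_pdivlMr // => tr.
pose q w := y + t *: v + w *m B.
(* Twice the bound on [phi 0], which is [- G (y + t *: v)]: a map with contraction factor 1/2 then
   preserves the ball of radius [rho]. *)
pose rho := 2 * e' * (`|t| * `|v|).
have nv : `|v| <= n by rewrite lerDl.
have Krho : K * rho <= e * `|t|.
  have -> : K * rho = (e' * K * `|v|) * 2 * `|t| by rewrite /rho; ring.
  rewrite ler_wpM2r // -ler_pdivlMr // -e'K ler_wpM2l // mulr_ge0 //; exact: ltW.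
have rho0 : 0 <= rho by rewrite /rho mulr_ge0 // mulr_ge0 // ltW.
have qB w : `|w| <= rho -> ball y r (q w).
  move=> wr; rewrite -ball_normE /ball_ /= /q.
  rewrite (_ : y - _ = - (t *: v + w *m B)); last by rewrite -addrA opprD addNKr.
  rewrite normrN; apply: le_lt_trans (ler_normD _ _) _.
  apply: le_lt_trans tr; rewrite normrZ /n mulrDr mulr1 lerD2l.
  apply: le_trans (KB _) _; apply: (@le_trans _ _ (K * rho)).
    by rewrite ler_wpM2l // ltW.
  by apply: le_trans Krho _; rewrite ler_piMl.
have rball : ball y r `<=` ball y r1 by exact: le_ball.
have qE w w' : q w - q w' = (w - w') *m B.
  by rewrite /q mulmxBl opprD addrACA subrr add0r.
pose phi w := w - G (q w).
have phiL w w' : `|w| <= rho -> `|w'| <= rho ->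
    `|phi w - phi w'| <= 2^-1 * `|w - w'|.
  move=> /qB/rball wr /qB/rball w'r.
  have := H1 _ _ w'r wr; rewrite qE -mulmxA BA mulmx1.
  rewrite -normrN; have -> : - (G (q w) - G (q w') - (w - w')) = phi w - phi w'.
    by rewrite /phi; apply/rowP => i; rewrite !mxE; ring.
  move/le_trans; apply; apply: (@le_trans _ _ (e' * (K * `|w - w'|))).
    by rewrite ler_wpM2l ?KB // ltW.
  rewrite mulrA ler_wpM2r //.
  have : e' * K * 1 <= e' * K * n.
    by rewrite ler_wpM2l ?lerDr // mulr_ge0 // ltW.
  by rewrite mulr1 e'K => /le_trans; apply; lra.
have phi0 : `|phi 0| <= rho / 2.
  have y0 : ball y r1 y by exact: ballxx.
  have q0 : `|(0 : 'rV[R]_m)| <= rho by rewrite normr0.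
  have := H1 _ _ y0 (rball _ (qB _ q0)).
  have -> : q 0 - y = t *: v by rewrite /q mul0mx addr0 addrC addKr.
  rewrite -scalemxAl vG scaler0 subr0 Gy subr0 normrZ /phi add0r normrN.
  by move/le_trans; apply; rewrite /rho; lra.
have phiB w : `|w| <= rho -> `|phi w| <= rho.
  move=> wr; rewrite -[phi w](subrK (phi 0)).
  apply: le_trans (ler_normD _ _) _.
  have := phiL w 0 wr; rewrite normr0 subr0 => /(_ rho0).
  by move: `|_| `|_| `|_| wr phi0 => a b c; lra.
have [w wr wE] := contraction_fixed_point rho0 phiB phiL.
have Gq : G (q w) = 0.
  by apply/eqP; move/eqP: wE; rewrite /phi -subr_eq0 addrAC subrr add0r oppr_eq0.
exists (q w).
  have : (U `&` G @^-1` [set 0]) (q w) by split=> //; exact/rU/qB.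
  by rewrite -MU => -[].
rewrite /q addrAC subrr add0r; apply: le_trans (KB _) _.
by apply: le_trans Krho; rewrite ler_wpM2l // ltW.
Qed.

(** Lyusternik's theorem gives points [p] of [M] at distance at most [e * t] from [y + t *: v]. As
    [h] vanishes at [p] and at [y], the derivative of [h] along [v] is bounded by a multiple of [e],
    for every small [e]. The local equation behind the tangent vector is arbitrary, so vectors
    coming from different equations obey the same constraints. *)
Lemma tangent_orth M y v V (h : 'rV[R]_d -> R) :
  M y -> tangent_space M y v -> open V -> V y -> Ck 1 V h ->
  (forall z, M z -> V z -> h z = 0) -> dot (grad h y) v = 0.
Proof.
move=> My [m [U [G [lG vG]]]] oV Vy ch h0.
set g := grad h y; set C := `|v| + 1 + d%:R * `|g|.
have C0 : 0 < C by rewrite ltr_wpDr ?mulr_ge0 // ltr_wpDl.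
have key (e : R) : 0 < e <= 1 -> `|dot g v| <= e * C.
  move=> /andP[e0 e1].
  have [r1 r10 H1] := C1_strict_diff oV Vy ch e0.
  have [r [r0 rr1 rV]] := nbhs_ball_sub oV Vy r10.
  have e01 : 0 < e <= 1 by rewrite e0.
  have [r2 r20 H2] := local_equation_tangent lG My vG e01.
  have n0 : 0 < `|v| + 1 by rewrite ltr_wpDl.
  (* Below [r2] for Lyusternik's theorem, and small enough that [p], at distance at most
     [t * (|v| + 1)] from [y], lies in the ball of radius [r]. *)
  set t := Num.min r2 (r / (`|v| + 1)) / 2.
  have min0 : 0 < Num.min r2 (r / (`|v| + 1)) by rewrite lt_min r20 divr_gt0.
  have t0 : 0 < t by rewrite divr_gt0.
  have tmin : t < Num.min r2 (r / (`|v| + 1)).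
    by rewrite ltr_pdivrMr // ltr_pMr // ltr1n.
  move: tmin; rewrite lt_min ltr_pdivlMr // => /andP[tr2 tr].
  have [|p Mp pt] := H2 t; first by rewrite gtr0_norm.
  rewrite gtr0_norm // in pt.
  have py : `|p - y| <= t * (`|v| + 1).
    have -> : p - y = (p - (y + t *: v)) + t *: v by rewrite opprD addrA subrK.
    apply: le_trans (ler_normD _ _) _; rewrite normrZ gtr0_norm //.
    rewrite mulrDr mulr1 addrC lerD2l; apply: le_trans pt _.
    by rewrite ler_piMl // ltW.
  have pr : ball y r p.
    by rewrite -ball_normE /ball_ /= distrC; exact: le_lt_trans tr.
  have := H1 y p (ballxx _ r10) (le_ball rr1 pr).
  rewrite (h0 p Mp (rV _ pr)) (h0 y My Vy) subr0 sub0r normrN -/g => gp.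
  (* The first term is small by strict differentiability of [h], the second because [p] is close to
     [y + t *: v]; the two bounds add up to [t * (e * C)]. *)
  have dE : t * dot g v = dot g (p - y) - dot g (p - (y + t *: v)).
    by rewrite -dotBr -dotZr; congr dot; apply/rowP => i; rewrite !mxE; ring.
  have : t * `|dot g v| <= t * (e * C).
    rewrite -{1}(gtr0_norm t0) -normrM dE.
    rewrite (_ : t * (e * C) = e * (t * (`|v| + 1)) + d%:R * `|g| * (e * t));
      last by rewrite /C; ring.
    apply: le_trans (ler_normB _ _) _; apply: lerD.
      by apply: le_trans gp _; rewrite ler_wpM2l // ltW.
    by apply: le_trans (abs_dot_le _ _) _; rewrite ler_wpM2l // mulr_ge0.
  by rewrite ler_pM2l.
apply/eqP; rewrite -normr_eq0; apply/negP => /negP a0.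
have {}a0 : 0 < `|dot g v| by rewrite lt_def a0 normr_ge0.
(* With [a = |dot g v| > 0], the choice [e = a / (C + a)] would give [a <= a * C / (C + a)], which
   is less than [a]. *)
have := key (`|dot g v| / (C + `|dot g v|)).
set a := `|_| in a0 *.
have Ca : 0 < C + a by rewrite addr_gt0.
rewrite divr_gt0 // ler_pdivrMr // mul1r lerDr (ltW C0) => /(_ isT).
by rewrite mulrAC ler_pdivlMr // ler_pM2l // gerDl leNgt a0.
Qed.

End Tangent.

(** * Local agreement and one-sided comparison of functions *)

Lemma near_eq_differentiable {R : numFieldType} {V W : normedModType R}
    (f h : V -> W) (u : V) : (\forall z \near u, f z = h z) ->
  differentiable h u -> differentiable f u.
Proof.
move=> fh dh; have fhu : f u = h u by exact: nbhs_singleton fh.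
have E : f \o shift u = cst (f u) + 'd h u +o_ 0 id.
  apply/eqaddoP => e e0.
  have := diff_locally dh => /eqaddoP/(_ e e0) H.
  have fh0 : \forall z \near 0, f (z + u) = h (z + u).
    by move: fh; rewrite (near_shift 0) /= subr0.
  apply: filterS2 H fh0 => z /= H fhz.
  by move: H; rewrite !fctE /= fhz fhu.
apply/diff_locallyP.
by rewrite (diff_unique (diff_continuous dh) E); split=> //; exact: diff_continuous.
Qed.

Section Local.
Context {R : realType} {d : nat}.
Implicit Types (f h phi : 'rV[R]_d -> R) (x u v : 'rV[R]_d) (U : set 'rV[R]_d).

Lemma increasing_direction phi u v : differentiable phi u -> phi u = 0 ->
  0 < dot (grad phi u) v -> \forall t \near 0^'+, 0 < phi (u + t *: v).
Proof.
move=> dphi phi0 pos.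
have /cvg_dnbhs_at_right : (fun t : R => t^-1 *: ((phi \o shift u) (t *: v) - phi u))
    @ 0^' --> 'D_v phi u by exact/diff_derivable.
rewrite deriveE // diff_grad => /(cvgr_gt _)/(_ _ pos) H.
near=> t.
have t0 : 0 < t by near: t; exact: nbhs_right_gt.
have : 0 < t^-1 *: ((phi \o shift u) (t *: v) - phi u) by near: t.
by rewrite /= phi0 subr0 addrC [_ *: _]mulrC pmulr_lgt0 // invr_gt0.
Unshelve. all: by end_near. Qed.

Lemma cvg_ray u v : (fun t : R => u + t *: v) @ 0^'+ --> u.
Proof.
rewrite -[X in _ --> X]addr0 -(scale0r v).
apply: cvgD; first exact: cvg_cst.
by apply: cvgZr_tmp; exact: cvg_at_right_filter.
Qed.

(** First-order optimality: [h - f] has a local maximum at [u]. If its gradient were nonzero, moving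
    along it would make [h - f] positive. *)
Lemma touching_grad f h u : differentiable f u -> differentiable h u ->
  (\forall z \near u, h z <= f z) -> h u = f u -> grad f u = grad h u.
Proof.
move=> df dh hf hfu; apply/eqP; rewrite -subr_eq0; apply/eqP.
rewrite -gradB //; apply: dot_eq0; apply/eqP.
set g := grad _ u; rewrite eq_le dot_ge0 andbT leNgt; apply/negP => g0.
have : 0 < dot (grad (fun z => h z - f z) u) (- g).
  by rewrite dotNr gradB // -dotNl opprB -gradB.
move=> /increasing_direction -/(_ _ _) H.
have {}H : \forall t \near 0^'+, 0 < h (u + t *: - g) - f (u + t *: - g).
  by apply: H; [exact: differentiableB | rewrite hfu subrr].
have hf' : \forall t \near 0^'+, h (u + t *: - g) <= f (u + t *: - g).
  exact: (@cvg_ray u (- g) _ hf).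
have [t [/=]] := filter_ex (filterI H hf').
by rewrite subr_gt0 => /lt_le_trans/[apply]; rewrite ltxx.
Qed.

Lemma near_eq_grad f h u : (\forall z \near u, f z = h z) ->
  differentiable h u -> grad f u = grad h u.
Proof.
move=> fh dh; apply: touching_grad => //.
- exact: near_eq_differentiable fh dh.
- by apply: filterS fh => z ->.
- by rewrite (nbhs_singleton fh).
Qed.

Lemma Ck_ext p U f h : open U -> (forall z, U z -> f z = h z) ->
  Ck p U h -> Ck p U f.
Proof.
move=> oU; elim: p f h => [|p ihp] f h fh /=.
  move=> ch z Uz; have := ch z Uz; rewrite /prop_for /continuous_at -(fh z Uz).
  apply: cvg_trans; apply: (@near_eq_cvg _ _ (nbhs z) (nbhs_filter z)).
  have nU : nbhs z U by exact: open_nbhs_nbhs.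
  by apply: filterS nU => w /fh.
move=> [dh ch]; have nfh z : U z -> \forall w \near z, f w = h w.
  move=> Uz; have nU : nbhs z U by exact: open_nbhs_nbhs.
  by apply: filterS nU => w /fh.
split=> [z Uz|i]; first exact: near_eq_differentiable (nfh z Uz) (dh z Uz).
apply: ihp (ch i) => z Uz.
by rewrite (near_eq_grad (nfh z Uz) (dh z Uz)).
Qed.

(** By induction on [p]. The gradient of the difference is known to be the difference of the
    gradients only on [U], hence the appeal to [Ck_ext]. *)
Lemma CkB p U f h : open U -> Ck p U f -> Ck p U h ->
  Ck p U (fun z => f z - h z).
Proof.
move=> oU; elim: p f h => [|p ihp] f h /=.
  by move=> cf ch z Uz; exact: (cvgB (cf z Uz) (ch z Uz)).
move=> [df cf] [dh ch]; split=> [z Uz|i].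
  by apply: differentiableB; [exact: df | exact: dh].
apply: Ck_ext (ihp _ _ (cf i) (ch i)) => // z Uz.
by rewrite gradB ?mxE //; [exact: df | exact: dh].
Qed.

End Local.

(** * Linear algebra *)

Section LinearAlgebra.
Context {R : realType} {d : nat}.

(** [orth_proj] is defined by [get], so its properties follow once a projection exists. The explicit
    one is [v - v A (A^T A)^-1 A^T], where full rank of [A] makes the Gram matrix invertible. *)
Lemma orth_proj_kernel m (A : 'M[R]_(d, m)) (T : set 'rV[R]_d) v :
  row_full A -> (forall z, T z <-> z *m A = 0) ->
  T (orth_proj T v) /\ forall z, T z -> dot (v - orth_proj T v) z = 0.
Proof.
move=> fullA TE.
suff : exists w, [set w | T w /\ forall z, T z -> dot (v - w) z = 0] w by move/getPex.
have AtA : A^T *m A \in unitmx.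
  rewrite -row_free_unit; apply: inj_row_free => x xA.
  have xAt : x *m A^T = 0.
    by apply: dot_eq0; rewrite dot_mul trmx_mul trmxK mulmxA -(mulmxA x) xA
      mul0mx mxE.
  move/row_fullP: fullA => [B BA].
  by rewrite -[x]mulmx1 -trmx1 -BA trmx_mul mulmxA xAt mul0mx.
exists (v - v *m A *m invmx (A^T *m A) *m A^T); split=> [|z /TE zA].
  by apply/TE; rewrite mulmxBl -!mulmxA mulVmx // mulmx1 subrr.
rewrite opprB addrC subrK dot_mul -mulmxA -trmx_mul zA trmx0 mulmx0.
by rewrite mxE.
Qed.

(** Appending a column of ones turns affine independence of the [g j] into linear independence of
    rows. A column of a right inverse of that matrix yields [w] and, as its last entry, [s]. *)
Lemma affinely_independent_dual (I : finType) (g : I -> 'rV[R]_d) (i : I) :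
  affinely_independent g ->
  exists w s, forall j, dot (g j) w + s = (j == i)%:R.
Proof.
move=> indep.
pose A : 'M[R]_(#|I|, d + 1) :=
  row_mx (\matrix_k g (enum_val k)) (const_mx 1).
have /row_freeP[B AB] : row_free A.
  apply: inj_row_free => c; rewrite mul_mx_row -row_mx0 => /eq_row_mx[cg c1].
  have c0 : forall j, c 0 (enum_rank j) = 0.
    apply: indep.
      move/matrixP: c1 => /(_ 0 0); rewrite !mxE => c1; rewrite -[RHS]c1.
      rewrite (reindex _ (onW_bij _ (enum_val_bij I))) /=.
      by apply: eq_bigr => k _; rewrite mxE mulr1 enum_valK.
    rewrite -[RHS]cg mulmx_sum_row (reindex _ (onW_bij _ (enum_val_bij I))) /=.
    by apply: eq_bigr => k _; rewrite rowK enum_valK.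
  by apply/rowP => k; rewrite mxE -(enum_valK k).
exists (usubmx (col (enum_rank i) B))^T, (dsubmx (col (enum_rank i) B) 0 0).
move=> j; move/matrixP: AB => /(_ (enum_rank j) (enum_rank i)).
rewrite [RHS]mxE (inj_eq enum_rank_inj) => ABji; rewrite -[RHS]ABji.
rewrite [RHS]mxE big_split_ord /= big_ord1; congr (_ + _).
  by apply: eq_bigr => k _; rewrite /A row_mxEl !mxE enum_rankK.
by rewrite /A row_mxEr !mxE mul1r.
Qed.

Lemma affinely_independent_dualB (I : finType) (g : I -> 'rV[R]_d) (i : I) :
  affinely_independent g ->
  exists w, forall j k, dot (g j - g k) w = (j == i)%:R - (k == i)%:R.
Proof.
move=> /(affinely_independent_dual i)[w [s ws]]; exists w => j k.
by rewrite -!ws dotBl [dot (g k) w + s]addrC addrKA.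
Qed.

(** Averaging [dot (g k) w + s] with the weights [mu] gives [s], because the [g k] average to 0, and
    gives [mu i] by duality. *)
Lemma affinely_independent_dual_multiplier (I : finType) (g : I -> 'rV[R]_d)
    (mu : I -> R) (i : I) :
  affinely_independent g -> \sum_j mu j = 1 -> \sum_j mu j *: g j = 0 ->
  exists w, forall j, dot (g j) w = (j == i)%:R - mu i.
Proof.
move=> /(affinely_independent_dual i)[w [s ws]] mu1 muE; exists w => j.
suff -> : mu i = s by rewrite -ws addrK.
have : \sum_k mu k * (dot (g k) w + s) = mu i.
  rewrite (bigD1 i) //= ws eqxx mulr1 big1 ?addr0 // => k /negPf ki.
  by rewrite ws ki mulr0.
move=> <-; rewrite (eq_bigr (fun k => dot (mu k *: g k) w + mu k * s)).
  by rewrite big_split /= -dot_suml muE dot0l add0r -mulr_suml mu1 mul1r.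
by move=> k _; rewrite mulrDr dotZl.
Qed.

(** If [B] is a left inverse of [A x], then [B *m A z] is close to the identity for [z] near [x],
    hence invertible: a kernel vector [v] would satisfy [v = v *m (1%:M - B *m A z)], whose norm is
    less than that of [v]. *)
Lemma near_row_full (T : topologicalType) m (x : T) (A : T -> 'M[R]_(d, m)) :
  row_full (A x) -> (forall i j, {for x, continuous (fun z => A z i j)}) ->
  \forall z \near x, row_full (A z).
Proof.
move=> /row_fullP[B BA] cA.
(* The [m * m] entries, each below [e], must add up to less than 1; the added 1 also covers
   [m = 0]. *)
pose e : R := (m%:R * m%:R + 1)^-1.
have e0 : 0 < e by rewrite invr_gt0 ltr_wpDl // mulr_ge0.
have cBA k l : (fun z => (1%:M - B *m A z) k l) @ x --> (0 : R).
  have -> : (0 : R) = (1%:M : 'M[R]_m) k l - \sum_i B k i * A x i l.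
    by rewrite -BA [X in X - _]mxE subrr.
  rewrite (_ : (fun z => _) = (fun z => (1%:M : 'M[R]_m) k l - \sum_i B k i * A z i l)).
    apply: cvgB; first exact: cvg_cst.
    by apply: cvg_sumr => i; apply: cvgMl_tmp; exact: cA.
  by apply/funext => z; rewrite [LHS]mxE [X in _ + X]mxE [X in _ - X]mxE.
have H : \forall z \near x, forall kl : 'I_m * 'I_m,
    `|(1%:M - B *m A z) kl.1 kl.2| < e.
  apply: filter_forall => -[k l] /=.
  have /cvgr0_norm_lt := cBA k l; exact.
apply: filterS H => z Hz.
have BAu : B *m A z \in unitmx.
  rewrite -row_free_unit; apply: inj_row_free => v vBA; apply/eqP.
  rewrite -normr_eq0; apply/negP => /negP v0.
  have {}v0 : 0 < `|v| by rewrite lt_def v0 normr_ge0.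
  have := mulmx_norm_le (1%:M - B *m A z) v.
  rewrite mulmxBr mulmx1 vBA subr0; apply/negP; rewrite -ltNge.
  rewrite gtr_pMl //; apply: (@le_lt_trans _ _ (\sum_(k < m) \sum_(l < m) e)).
    by apply: ler_sum => k _; apply: ler_sum => l _; exact/ltW/(Hz (k, l)).
  rewrite !sumr_const !card_ord -mulrnA -mulr_natl natrM.
  by rewrite ltr_pdivrMr ?mul1r ?ltrDl // ltr_wpDl // mulr_ge0.
apply/row_fullP; exists (invmx (B *m A z) *m B).
by rewrite -mulmxA mulVmx.
Qed.

End LinearAlgebra.

(** * Clarke subdifferential of a maximum *)

Section ConvexCombination.
Context {R : realType} {d : nat} {I : finType}.
Implicit Types (g : I -> 'rV[R]_d) (J : I -> Prop) (A : set 'rV[R]_d).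

(** Weights live on all of [I] and vanish off [J], so that combinations supported on different index
    sets can be compared coefficientwise. *)
Definition convex_combination J g : set 'rV[R]_d :=
  [set v | exists lam : I -> R, [/\ forall i, 0 <= lam i, \sum_i lam i = 1,
     forall i, ~ J i -> lam i = 0 & v = \sum_i lam i *: g i]].

Lemma convex_combination_convex J g :
  convex_set (convex_combination J g : set (convex_lmodType 'rV[R]_d)).
Proof.
move=> u v t; rewrite !inE => -[a [a0 a1 aJ ->]] [b [b0 b1 bJ ->]].
exists (fun i => t%:num * a i + (1 - t%:num) * b i); split.
- by move=> i; rewrite addr_ge0 // mulr_ge0 // subr_ge0.
- by rewrite big_split -!mulr_sumr a1 b1 !mulr1 /= addrC subrK.
- by move=> i Ji; rewrite aJ // bJ // !mulr0 addr0.
rewrite /conv /= !scaler_sumr -big_split; apply: eq_bigr => i _.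
by rewrite !scalerA scalerDl.
Qed.

Lemma convex_combination1 J g i : J i -> convex_combination J g (g i).
Proof.
move=> Ji; exists (fun j => (j == i)%:R); split.
- by move=> j; rewrite ler0n.
- by rewrite (bigD1 i) //= eqxx big1 ?addr0 // => j /negPf ->.
- by move=> j Jj; case: eqP => // ji; rewrite ji in Jj.
by rewrite (bigD1 i) //= eqxx scale1r big1 ?addr0 // => j /negPf ->; rewrite scale0r.
Qed.

Lemma convex_hull_sub_combination A J g :
  (forall v, A v -> exists2 i, J i & v = g i) ->
  convex_hull A `<=` convex_combination J g.
Proof.
move=> Ag; apply: smallest_sub; first exact: convex_combination_convex.
by move=> v /Ag[i Ji ->]; exact: convex_combination1.
Qed.

End ConvexCombination.

Section Max.
Context {R : realType} {d : nat} {I : finType}.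
Variables (f : 'rV[R]_d -> R) (fs : I -> 'rV[R]_d -> R).
Implicit Types x : 'rV[R]_d.
Hypothesis fsC1 : forall i, Ck 1 setT (fs i).

(** The maximum is described by its bound and its attainment, which frees the arguments from the
    seed index of the iterated maximum. *)
Definition is_max x := (forall i, fs i x <= f x) /\ exists i, fs i x = f x.

Lemma bigmax_is_max i0 x :
  f x = \big[Num.max/fs i0 x]_i fs i x -> is_max x.
Proof.
move=> fx; split=> [i|]; rewrite fx; first exact: le_bigmax.
elim/big_ind: _ => [|a b [i ia] [j jb]|i _]; [by exists i0| |by exists i].
by case: (leP a b) => _; [exists j | exists i].
Qed.

Let dfs i x : differentiable (fs i) x.
Proof. exact: Ck_differentiable (fsC1 i) _. Qed.

Let cfs i x : fs i @ x --> fs i x.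
Proof. exact/differentiable_continuous. Qed.

Let cgrad i x : grad (fs i) @ x --> grad (fs i) x.
Proof. by apply: (@grad_continuous _ _ setT) => //; exact: openT. Qed.

Lemma grad_max i x : (\forall z \near x, is_max z) -> differentiable f x ->
  fs i x = f x -> grad f x = grad (fs i) x.
Proof.
move=> fmax df fi; apply: touching_grad => //.
by apply: filterS fmax => z [].
Qed.

(** Otherwise every piece is eventually inactive along the sequence: a piece inactive at [x] by
    continuity, and a piece active at [x] because its gradients, which equal those of [f] wherever
    it is active, do not tend to [g]. Since [I] is finite, some [u k] would have no active piece at
    all. *)
Lemma limiting_gradients_max x g : (\forall z \near x, is_max z) ->
  limiting_gradients f x g -> exists2 i, fs i x = f x & g = grad (fs i) x.
Proof.
move=> fmax [u [ux du gu]].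
have fxmax : is_max x by exact: nbhs_singleton fmax.
have umax : \forall k \near \oo, \forall z \near u k, is_max z.
  by have /near_join := fmax; exact: ux.
apply: contrapT => noi.
have inactive i : \forall k \near \oo, fs i (u k) != f (u k).
  have [fi|fi] := eqVneq (fs i x) (f x).
    have gi : g - grad (fs i) x != 0.
      by apply/eqP => /subr0_eq gi; apply: noi; exists i.
    have : (fun k => grad f (u k) - grad (fs i) (u k)) @ \oo --> g - grad (fs i) x.
      exact: (cvgB gu (cvg_comp _ _ ux (@cgrad i x))).
    move=> /cvgr_neq0/(_ gi) H; apply: filterS2 H umax => k H umax.
    by apply: contra H => /eqP fik; rewrite (grad_max umax (du k) fik) subrr.
  have [j fj] := fxmax.2.
  have fij : 0 < fs j x - fs i x by rewrite fj subr_gt0 lt_neqAle fi fxmax.1.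
  have : (fun k => fs j (u k) - fs i (u k)) @ \oo --> fs j x - fs i x.
    by apply: cvgB; [exact: (cvg_comp _ _ ux (@cfs j x)) |
                     exact: (cvg_comp _ _ ux (@cfs i x))].
  move=> /cvgr_gt/(_ _ fij) H; apply: filterS2 H umax => k H umax.
  have [fjk _] := nbhs_singleton umax.
  by rewrite subr_gt0 in H; rewrite lt_eqF // (lt_le_trans H).
have allin : \forall k \near \oo, forall i, fs i (u k) != f (u k).
  exact: filter_forall.
have [k [kin /nbhs_singleton[_ [i fik]]]] := filter_ex (filterI allin umax).
by have := kin i; rewrite fik eqxx.
Qed.

Lemma clarke_max x : (\forall z \near x, is_max z) ->
  clarke f x `<=` convex_combination (fun i => fs i x = f x) (fun i => grad (fs i) x).
Proof.
by move=> fmax; apply: convex_hull_sub_combination => v; exact: limiting_gradients_max.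
Qed.

(** On the ray from [x] along [w], for small [t > 0], the piece [i] strictly dominates all others.
    Hence [f] agrees with [fs i] around each such point, and its gradients there converge to the
    gradient of [fs i] at [x]. *)
Lemma limiting_gradient_exposed x w i : (\forall z \near x, is_max z) ->
  fs i x = f x -> (forall j, j != i -> 0 < dot (grad (fs i) x - grad (fs j) x) w) ->
  limiting_gradients f x (grad (fs i) x).
Proof.
move=> fmax fi expo.
have fmax' : \forall z \near x, \forall y \near z, is_max y by exact/near_join.
have fxmax : is_max x by exact: nbhs_singleton fmax.
have ray : \forall t \near 0^'+, forall j, j != i ->
    fs j (x + t *: w) < fs i (x + t *: w).
  suff : \forall t \near 0^'+, forall j : I, (j != i) ==>
      (fs j (x + t *: w) < fs i (x + t *: w)).
    by apply: filterS => t H j; apply/implyP.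
  apply: filter_forall => j; have [->|ji] := eqVneq j i; first exact: nearW.
  have [fj|fj] := eqVneq (fs j x) (fs i x).
    have : \forall t \near 0^'+, 0 < fs i (x + t *: w) - fs j (x + t *: w).
      apply: (@increasing_direction _ _ (fun z => fs i z - fs j z)).
      - exact: differentiableB.
      - by rewrite fj subrr.
      - by rewrite gradB // expo.
    by apply: filterS => t; rewrite subr_gt0.
  have : (fun t => fs i (x + t *: w) - fs j (x + t *: w)) @ 0^'+ --> fs i x - fs j x.
    by apply: cvgB; [exact: (cvg_comp _ _ (@cvg_ray _ _ x w) (@cfs i x)) |
                     exact: (cvg_comp _ _ (@cvg_ray _ _ x w) (@cfs j x))].
  move=> /cvgr_gt/(_ 0); rewrite subr_gt0 lt_neqAle fj fi fxmax.1 => /(_ isT).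
  by apply: filterS => t; rewrite subr_gt0.
have rmax : \forall t \near 0^'+, \forall y \near x + t *: w, is_max y.
  exact: (@cvg_ray _ _ x w _ fmax').
have near_lt p : (forall j, j != i -> fs j p < fs i p) ->
    \forall y \near p, forall j, j != i -> fs j y < fs i y.
  move=> plt.
  suff : \forall y \near p, forall j : I, (j != i) ==> (fs j y < fs i y).
    by apply: filterS => y H j; apply/implyP.
  apply: (@filter_forall _ _ _ (nbhs p) (nbhs_filter p)) => j.
  have [->|ji] := eqVneq j i; first exact: nearW.
  have := cvgr_gt _ (cvgB (@cfs i p) (@cfs j p)) 0.
  rewrite subr_gt0 => /(_ (nbhs_filter p) (nbhs_filter p) (plt j ji)).
  by apply: filterS => y; rewrite subr_gt0.
have feq : \forall t \near 0^'+, \forall y \near x + t *: w, f y = fs i y.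
  apply: filterS2 ray rmax => t tray tmax.
  apply: filterS2 (near_lt _ tray) tmax => y ylt [yle [j fj]].
  have [<-//|/ylt] := eqVneq j i.
  by rewrite fj ltNge yle.
have [r /= r0 rfeq] : exists2 r : R, 0 < r &
    forall t, 0 < t -> t < r -> \forall y \near x + t *: w, f y = fs i y.
  have [r /= r0 rfeq] := feq; exists r => // t t0 tr; apply: rfeq => //.
  by rewrite /ball_ /= sub0r normrN gtr0_norm.
(* A sequence in the open interval from 0 to [r] tending to 0: differentiability is required at
   every term, not only eventually. *)
pose t (k : nat) : R := r / 2 / k.+1%:R.
have t0 k : 0 < t k by rewrite !divr_gt0.
have tr k : t k < r.
  rewrite /t ltr_pdivrMr // (@lt_le_trans _ _ r) //.
    by rewrite ltr_pdivrMr // ltr_pMr // ltr1n.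
  by rewrite ler_peMr ?ler1n // ltW.
have fk k : \forall y \near x + t k *: w, f y = fs i y by exact: rfeq.
have ux : (fun k => x + t k *: w) @ \oo --> x.
  rewrite -[X in _ --> X]addr0 -(scale0r w).
  apply: cvgD; first exact: cvg_cst.
  apply: cvgZr_tmp; rewrite -(mulr0 (r / 2)); apply: cvgMl_tmp.
  exact: cvg_harmonic.
exists (fun k => x + t k *: w); split=> //.
  by move=> k; exact: near_eq_differentiable (fk k) _.
rewrite (_ : (fun k => _) = (fun k => grad (fs i) (x + t k *: w))); last first.
  by apply/funext => k; exact: near_eq_grad (fk k) _.
exact: (cvg_comp _ _ ux (@cgrad i x)).
Qed.

End Max.

(** * Positive multipliers from the relative interior *)

Section Multipliers.
Context {R : realType} {d : nat} {I : finType}.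
Variables (g : I -> 'rV[R]_d) (J : I -> Prop) (C : set 'rV[R]_d).
Hypothesis indep : affinely_independent g.

(** Relative interiority puts [- t *: g i] in [C] for some [t > 0], with weights [nu]. Adding [t] to
    [nu i] and dividing by [1 + t] represents 0 with total weight 1, so affine independence
    identifies the result with [mu], and [mu i = (nu i + t) / (1 + t) > 0]. *)
Lemma relint_positive_multipliers :
  C `<=` convex_combination J g -> (forall i, J i -> C (g i)) -> relint C 0 ->
  exists mu : I -> R, [/\ forall i, J i -> 0 < mu i,
    forall i, ~ J i -> mu i = 0, \sum_i mu i = 1 & \sum_i mu i *: g i = 0].
Proof.
move=> CJ gC [C0 riC].
have [mu [mu0 mu1 muJ muE]] := CJ _ C0.
exists mu; split=> // i Ji; rewrite lt_neqAle mu0 andbT.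
(* This point lies on the line through 0 and [g i], at parameter [- t]. *)
have aff (t : R) : affine_hull C (t *: - g i).
  move=> A [affA CA]; have := affA 0 (g i) (- t) (CA _ C0) (CA _ (gC _ Ji)).
  by rewrite scaler0 add0r scaleNr scalerN.
have riC' : \forall t \near 0^'+, C (t *: - g i).
  have H : \forall t \near 0^'+,
      affine_hull C (0 + t *: - g i) -> C (0 + t *: - g i).
    exact: (@cvg_ray R d 0 (- g i) _ riC).
  by apply: filterS H => t; rewrite add0r; apply; exact: aff.
have [t [t0 Ct]] : exists t : R, 0 < t /\ C (t *: - g i).
  by have [t []] := filter_ex (filterI (nbhs_right_gt (0 : R)) riC'); exists t.
have [nu [nu0 nu1 nuJ nuE]] := CJ _ Ct.
have t1 : 1 + t != 0 by rewrite gt_eqF // addr_gt0.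
have sum_delta : \sum_j t * (j == i)%:R = t.
  rewrite (bigD1 i) //= eqxx mulr1 big1 ?addr0 // => j /negPf ->.
  by rewrite mulr0.
have /(_ i) : forall j, (1 + t) * mu j - (nu j + t * (j == i)%:R) = 0.
  apply: indep.
    by rewrite sumrB big_split -mulr_sumr mu1 nu1 sum_delta mulr1 subrr.
  rewrite (eq_bigr (fun j => (1 + t) *: (mu j *: g j) -
      (nu j *: g j + (t * (j == i)%:R) *: g j))); last first.
    by move=> j _; rewrite scalerA -scalerDl -scalerBl.
  rewrite sumrB big_split /= -scaler_sumr -muE -nuE scaler0 sub0r.
  rewrite (bigD1 i) //= eqxx mulr1 big1 => [|j /negPf ->]; last first.
    by rewrite mulr0 scale0r.
  by rewrite addr0 scalerN addNr oppr0.
rewrite eqxx mulr1 => /eqP; rewrite subr_eq0 => /eqP E.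
apply/eqP => mui; move: E; rewrite -mui mulr0 => /esym/eqP.
by rewrite gt_eqF // ltr_wpDl.
Qed.

End Multipliers.

(** * Uniform second-order estimates for a finite family *)

Section Taylor.
Context {R : realType} {d : nat} {I : finType}.
Variables (fs : I -> 'rV[R]_d -> R) (x : 'rV[R]_d).
Hypothesis fsC2 : forall i, Ck 2 setT (fs i).

Lemma grad_lipschitz_family : exists2 L : R, 0 < L & \forall p \near x & q \near x,
  forall i, `|grad (fs i) q - grad (fs i) p| <= L * `|q - p|.
Proof.
have /boolp.choice[L HL] : forall i, exists L, 0 < L /\
    \forall p \near x & q \near x,
      `|grad (fs i) q - grad (fs i) p| <= L * `|q - p|.
  by move=> i; have [L L0 HL] := @C2_grad_lipschitz _ _ _ _ x openT Logic.I (fsC2 i); exists L.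
exists (1 + \sum_i L i).
  by rewrite ltr_wpDr // sumr_ge0 // => i _; case: (HL i) => /ltW.
have H : \forall p \near x & q \near x, forall i,
    `|grad (fs i) q - grad (fs i) p| <= L i * `|q - p|.
  apply: (@filter_forall _ _ _ _ (filter_prod_filter (nbhs_filter x) (nbhs_filter x))) => i.
  by case: (HL i).
apply: filterS H => -[p q] /= H i; apply: le_trans (H i) _; rewrite ler_wpM2r //.
rewrite (bigD1 i) //= addrCA lerDl addr_ge0 // sumr_ge0 // => j _.
by case: (HL j) => /ltW.
Qed.

(** By the mean value theorem the increment of [fs i] is a gradient at an intermediate point tested
    on [y - z]; Lipschitz continuity bounds its distance to the gradient at [z]. *)
Lemma taylor_lower_family : exists K : R, \forall y \near x & z \near x, forall i,
  fs i z + dot (grad (fs i) z) (y - z) - K * enorm (y - z) ^+ 2 <= fs i y.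
Proof.
have [L L0 [[A B] [/= Ax Bx] AB]] := grad_lipschitz_family.
exists (d%:R * L).
have [r r0 rAB] : nbhs_ball x (A `&` B) by apply/nbhs_ballP; exact: filterI.
exists (ball x r, ball x r); first by split; exact: nbhsx_ballx.
move=> [y z] [/= yr zr] i.
have dfs p : setT p -> differentiable (fs i) p.
  by move=> _; exact: Ck_differentiable (fsC2 i) _.
have [t [/andP[t0 t1] tr fE]] :=
  mean_value_ball (@subsetT _ (ball x r)) dfs zr yr.
have : `|(z + t *: (y - z)) - z| <= `|y - z|.
  by rewrite addrC addKr normrZ ger0_norm // ler_piMl.
move: (z + t *: (y - z)) tr fE => xi tr fE xiz.
have key : dot (grad (fs i) z) (y - z) - (fs i y - fs i z) <=
    d%:R * L * enorm (y - z) ^+ 2.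
  rewrite fE -dotBl; apply: le_trans (ler_norm _) _.
  apply: le_trans (abs_dot_le _ _) _; rewrite -!mulrA ler_wpM2l // expr2 mulrA.
  rewrite ler_pM ?norm_le_enorm //.
  have [/= Axi _] := rAB _ tr; have [_ Bz] := rAB _ zr.
  apply: le_trans (AB (xi, z) (conj Axi Bz) i) _; rewrite /= ler_wpM2l ?(ltW L0) //.
  by rewrite distrC; apply: le_trans xiz (norm_le_enorm _).
move: {fE} key; move: (dot _ _) (_ * _ ^+ 2) => a b; lra.
Qed.

End Taylor.

(** * The active manifold *)

Section MaxFunction.
Context {R : realType} {d : nat} {I : finType}.
Variables (f : 'rV[R]_d -> R) (fs : I -> 'rV[R]_d -> R) (xbar : 'rV[R]_d).
Variable istar : I.
Hypothesis fsC4 : forall i, Ck 4 setT (fs i).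
Hypothesis indep : affinely_independent (fun i => grad (fs i) xbar).
Hypothesis fmax : \forall x \near xbar, is_max f fs x.
Hypothesis istarP : fs istar xbar = f xbar.

Let active i := fs i xbar = f xbar.

Definition equality_manifold : set 'rV[R]_d :=
  [set x | forall i, fs i xbar = f xbar -> fs i x = fs istar x].

Local Notation M := equality_manifold.

Let fsC1 i : Ck 1 setT (fs i). Proof. exact: Ck_le (fsC4 i). Qed.
Let fsC2 i : Ck 2 setT (fs i). Proof. exact: Ck_le (fsC4 i). Qed.
Let dfs i x : differentiable (fs i) x.
Proof. exact: Ck_differentiable (fsC1 i) _. Qed.
Let cfs i x : fs i @ x --> fs i x.
Proof. exact/differentiable_continuous. Qed.

(** A piece inactive at [xbar] stays strictly below [fs istar] nearby, so no new piece becomes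
    active. *)
Lemma near_active : \forall x \near xbar,
  (\forall z \near x, is_max f fs z) /\ forall i, fs i x = f x -> active i.
Proof.
have fmax' : \forall x \near xbar, \forall z \near x, is_max f fs z by exact/near_join.
suff H : \forall x \near xbar, forall i, (fs i xbar != f xbar) ==> (fs i x < fs istar x).
  apply: filterS2 fmax' H => x xmax H; split=> // i fi; apply/eqP/negP => /negP ni.
  have [xle _] := nbhs_singleton xmax.
  by have := implyP (H i) ni; rewrite fi ltNge xle.
apply: (@filter_forall _ _ _ (nbhs xbar) (nbhs_filter xbar)) => i.
have [|ni] := eqVneq (fs i xbar) (f xbar); first by move=> _; exact: nearW.
have [xle _] := nbhs_singleton fmax.
have lt0 : 0 < fs istar xbar - fs i xbar by rewrite istarP subr_gt0 lt_neqAle ni xle.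
have := cvgr_gt _ (cvgB (@cfs istar xbar) (@cfs i xbar)) 0.
move=> /(_ (nbhs_filter _) (nbhs_filter _) lt0).
by apply: filterS => y; rewrite subr_gt0.
Qed.

(** Some piece attains the maximum at [y]; it is active at [xbar], and on [M] all such pieces take
    the same value. *)
Lemma on_manifold y i : is_max f fs y ->
  (forall j, fs j y = f y -> active j) -> M y -> active i -> fs i y = f y.
Proof.
by move=> [_ [j fj]] act My ai; rewrite (My _ ai) -fj (My j (act j fj)).
Qed.

Lemma tangent_grad_eq y i v : M y -> active i -> tangent_space M y v ->
  dot (grad (fs i) y - grad (fs istar) y) v = 0.
Proof.
move=> My ai Tv; rewrite -gradB //.
apply: (tangent_orth My Tv openT) => //; first exact: (CkB openT).
by move=> z Mz _; rewrite (Mz i ai) subrr.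
Qed.

(** [istar] is left out because its own equation is trivial and would contribute a zero column to
    the jacobian, destroying surjectivity. *)
Definition others : {set I} := [set i | (fs i xbar == f xbar) && (i != istar)].

Definition equality_map (x : 'rV[R]_d) : 'rV[R]_#|others| :=
  \row_k (fs (enum_val k) x - fs istar x).

Let equality_mapE k :
  (fun z => equality_map z 0 k) = (fun z => fs (enum_val k) z - fs istar z).
Proof. by apply/funext => z; rewrite mxE. Qed.

Lemma mul_jacobian_equality_map x v :
  v *m 'J equality_map x =
  \row_k dot (grad (fs (enum_val k)) x - grad (fs istar) x) v.
Proof.
rewrite mul_jacobian => [|k]; last by rewrite equality_mapE; exact: differentiableB.
by apply/rowP => k; rewrite !mxE equality_mapE gradB.
Qed.

Let cgrad i x : grad (fs i) @ x --> grad (fs i) x.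
Proof. by apply: (@grad_continuous _ _ setT) => //; exact: openT. Qed.

Let grad_coord_continuous i l x : (fun z => grad (fs i) z 0 l) @ x --> grad (fs i) x 0 l.
Proof. by case: (fsC1 i) => _ /(_ l x Logic.I). Qed.

Lemma jacobian_equality_mapE x l k : 'J equality_map x l k =
  grad (fs (enum_val k)) x 0 l - grad (fs istar) x 0 l.
Proof.
have -> : 'J equality_map x l k = ((delta_mx 0 l : 'rV_d) *m 'J equality_map x) 0 k.
  by rewrite -rowE [RHS]mxE.
by rewrite mul_jacobian_equality_map mxE dot_delta mxE [X in _ + X = _]mxE.
Qed.

(** The directions dual to the gradients of the pieces in [others], taken as rows, form a left
    inverse of the jacobian. *)
Lemma row_full_jacobian : row_full ('J equality_map xbar).
Proof.
have /boolp.choice[w wP] : forall k : 'I_#|others|, exists w, forall l : 'I_#|others|,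
    dot (grad (fs (enum_val l)) xbar - grad (fs istar) xbar) w = (k == l)%:R.
  move=> k; have [w wE] := affinely_independent_dualB (enum_val k) indep.
  exists w => l; rewrite wE.
  have := enum_valP k; rewrite inE => /andP[_]; rewrite eq_sym => /negPf ->.
  by rewrite subr0 (inj_eq enum_val_inj) (eq_sym k).
apply/row_fullP; exists (\matrix_k w k); apply/row_matrixP => k.
rewrite row_mul rowK mul_jacobian_equality_map row1.
by apply/rowP => l; rewrite mxE wP [RHS]mxE eqxx (eq_sym l).
Qed.

Lemma near_local_equation : exists2 U, nbhs xbar U &
  local_equation 4 M xbar U equality_map.
Proof.
have H : \forall z \near xbar, row_full ('J equality_map z).
  apply: near_row_full => [|l k]; first exact: row_full_jacobian.
  rewrite (_ : (fun z => _) = (fun z =>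
    grad (fs (enum_val k)) z 0 l - grad (fs istar) z 0 l)); last first.
    by apply/funext => z; exact: jacobian_equality_mapE.
  exact: (cvgB (@grad_coord_continuous _ _ _) (@grad_coord_continuous _ _ _)).
pose U := interior [set z | row_full ('J equality_map z)].
have oU : open U by exact: open_interior.
have Ux : U xbar by [].
exists U; first exact: open_nbhs_nbhs.
split=> //.
- move=> k; rewrite equality_mapE.
  by apply: (Ck_sub (@subsetT _ U)); apply: (CkB openT).
- by move=> z /interior_subset.
apply/seteqP; split=> z /= [].
  move=> Mz Uz; split=> //; apply/rowP => k; rewrite !mxE Mz ?subrr //.
  by have := enum_valP k; rewrite inE => /andP[/eqP].
move=> Uz /rowP Fz; split=> // i ai; have [->//|ni] := eqVneq i istar.
have iO : i \in others by rewrite inE ai eqxx.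
have := Fz (enum_rank_in iO i); rewrite !mxE enum_rankK_in // => /eqP.
by rewrite subr_eq0 => /eqP.
Qed.

Lemma manifold_active0 : M xbar.
Proof. by move=> i ->. Qed.

Lemma equality_manifold_nbhs : exists W, [/\ open W, W xbar &
  forall y, W y -> (\forall z \near y, is_max f fs z) /\
    forall j, fs j y = f y -> active j].
Proof.
pose W := interior [set y | (\forall z \near y, is_max f fs z) /\
    forall j, fs j y = f y -> active j].
exists W; split; [exact: open_interior | exact: near_active |].
by move=> y /interior_subset.
Qed.

Lemma equality_manifold_smooth : smooth_on 4 f M xbar.
Proof.
have [W [oW Wx WP]] := equality_manifold_nbhs.
exists (fs istar), W; split=> //; first exact: (Ck_sub (@subsetT _ W)).
move=> z Mz /WP[/nbhs_singleton zmax zact].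
by rewrite (on_manifold zmax zact Mz istarP).
Qed.

Lemma active_grad_clarke i : active i -> clarke f xbar (grad (fs i) xbar).
Proof.
move=> ai; apply: sub_gen_smallest.
have [w wE] := affinely_independent_dualB i indep.
apply: (limiting_gradient_exposed (w := w) fsC1 fmax ai) => j /negPf ji.
by rewrite wE eqxx ji subr0.
Qed.

Lemma sharp_off_manifold : relint (clarke f xbar) 0 ->
  exists2 U, nbhs xbar U &
    (0 < ereal_inf [set (enorm v)%:E | v in
                      \bigcup_(z in U `\` M) clarke f z])%E.
Proof.
move=> ri0.
have [mu [mu0 muN mu1 muE]] := relint_positive_multipliers indep
  (clarke_max fsC1 fmax) active_grad_clarke ri0.
have /boolp.choice[w wE] : forall i, exists w, forall j, j != i ->
    dot (grad (fs j) xbar) w = - mu i.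
  move=> i.
  have [w wE] := affinely_independent_dual_multiplier i indep mu1 muE.
  by exists w => j /negPf ji; rewrite wE ji sub0r.
have nw : \forall x \near xbar, forall ij : I * I, (active ij.1 /\ ij.2 != ij.1) ->
    dot (grad (fs ij.2) x) (w ij.1) < - (mu ij.1 / 2).
  suff : \forall x \near xbar, forall ij : I * I,
      ((fs ij.1 xbar == f xbar) && (ij.2 != ij.1)) ==>
      (dot (grad (fs ij.2) x) (w ij.1) < - (mu ij.1 / 2)).
    by apply: filterS => x H ij [ai ji]; apply: (implyP (H ij)); rewrite ai eqxx.
  apply: (@filter_forall _ _ _ (nbhs xbar) (nbhs_filter xbar)) => -[i j] /=.
  have [ai|] := eqVneq (fs i xbar) (f xbar); last by move=> _; exact: nearW.
  have [->|ji] := eqVneq j i; first exact: nearW.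
  have mulo : dot (grad (fs j) xbar) (w i) < - (mu i / 2).
    by rewrite (wE i j ji) ltrN2 ltr_pdivrMr // ltr_pMr ?mu0 // ltr1n.
  have cdot : (fun x => dot (grad (fs j) x) (w i)) @ xbar --> dot (grad (fs j) xbar) (w i).
    exact: (cvg_comp _ _ (@cgrad j xbar) (@dotl_continuous _ _ _ _)).
  exact: (@cvgr_lt _ _ (nbhs xbar) (nbhs_filter xbar) _ _ cdot _ mulo).
(* The bound obtained when [i] is the inactive piece, minimized over all candidates [i]; adding 1 to
   the norm of [w i] avoids a zero divisor. *)
pose c := \big[Num.min/1]_(i | fs i xbar == f xbar) (mu i / 2 / (enorm (w i) + 1)).
have c0 : 0 < c.
  apply/bigmin_gtP; split=> // i /eqP ai.
  by rewrite !divr_gt0 ?mu0 // ltr_wpDl // enorm_ge0.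
exists [set x | ((\forall z \near x, is_max f fs z) /\
    forall i, fs i x = f x -> active i) /\
    forall ij : I * I, (active ij.1 /\ ij.2 != ij.1) ->
    dot (grad (fs ij.2) x) (w ij.1) < - (mu ij.1 / 2)].
  by apply: filterI; [exact: near_active | exact: nw].
apply: (@lt_le_trans _ _ c%:E); first by rewrite lte_fin.
apply/ereal_infP => _ [v [x [[[xmax xact] xw] xM] xv] <-]; rewrite lee_fin.
have [lam [lam0 lam1 lamN vE]] := clarke_max fsC1 xmax xv.
have [i [ai ni]] : exists i, active i /\ fs i x <> f x.
  apply: contrapT => noi; apply: xM => i ai.
  have H j : active j -> fs j x = f x.
    by move=> aj; apply: contrapT => nj; apply: noi; exists j.
  by rewrite (H i ai) (H istar istarP).
have vw : dot v (w i) <= - (mu i / 2).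
  rewrite vE; apply: dot_combination_le => // j lamj.
  (* The weight of [i] vanishes because [i] is inactive at [x], so only gradients with [j != i]
     enter [v], and each is below [- (mu i / 2)] along [w i]. *)
  have ji : j != i by apply: contraNneq lamj => ->; apply/eqP/lamN.
  exact: (ltW (xw (i, j) (conj ai ji))).
have nwi : 0 < enorm (w i) + 1 by rewrite ltr_wpDl // enorm_ge0.
apply: (@le_trans _ _ (mu i / 2 / (enorm (w i) + 1))).
  by apply: bigmin_le_cond; apply/eqP.
rewrite ler_pdivrMr //; apply: (@le_trans _ _ (dot (- v) (w i))).
  by rewrite dotNl lerNr.
apply: le_trans (dot_le_enorm _ _) _.
by rewrite /enorm dotNl dotNr opprK ler_wpM2l ?sqrtr_ge0 // lerDl.
Qed.

Lemma active_equality_manifold : relint (clarke f xbar) 0 ->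
  active_manifold 4 f M xbar.
Proof.
move=> ri0; split; [exact: manifold_active0 | by case: ri0 | |
  exact: equality_manifold_smooth | exact: sharp_off_manifold].
have [U _ leU] := near_local_equation.
by exists #|others|, U, equality_map.
Qed.

(** The tangent space at [y] is the kernel of the jacobian of [equality_map]: [tangent_grad_eq] puts
    tangent vectors in the kernel, and [equality_map] is itself a local equation around [y]. *)
Lemma orth_proj_tangent U y v : local_equation 4 M xbar U equality_map ->
  U y -> M y -> tangent_space M y (orth_proj (tangent_space M y) v) /\
  forall z, tangent_space M y z ->
    dot (v - orth_proj (tangent_space M y) v) z = 0.
Proof.
move=> [oU _ cF fullF MU] Uy My; apply: orth_proj_kernel (fullF y Uy) _ => z.
split=> [Tz|Fz].
  rewrite mul_jacobian_equality_map; apply/rowP => k; rewrite !mxE.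
  apply: (tangent_grad_eq My _ Tz).
  by have := enum_valP k; rewrite inE => /andP[/eqP].
exists #|others|, U, equality_map; split=> //; split=> //.
by move=> k; exact: Ck_le (cF k).
Qed.

(** Whichever extension [fhat] the choice operator selects, [fs istar - fhat] vanishes on [M] near
    [y], so both gradients have the same tangential part. *)
Lemma covariant_grad_orth U W y z : local_equation 4 M xbar U equality_map ->
  U y -> M y -> open W -> W y ->
  (forall p, M p -> W p -> f p = fs istar p) -> tangent_space M y z ->
  dot (grad (fs istar) y - covariant_grad f M y) z = 0.
Proof.
move=> leU Uy My oW Wy fW Tz.
have : exists g, [set g | exists2 fhat, smooth_extension 1 f M y fhat &
    g = orth_proj (tangent_space M y) (grad fhat y)] g.
  exists (orth_proj (tangent_space M y) (grad (fs istar) y)), (fs istar) => //.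
  by exists W; split=> //; exact: (Ck_sub (@subsetT _ W)).
move=> /getPex; rewrite -/(covariant_grad f M y) => -[fhat [V [oV Vy cV fV]] ->].
have [_ /(_ z Tz)] := orth_proj_tangent (grad fhat y) leU Uy My.
move: (orth_proj _ _) => p orth.
have oVW : open (V `&` W) by exact: openI.
have cVW : Ck 1 (V `&` W) (fun q => fs istar q - fhat q).
  apply: CkB => //; first exact: (Ck_sub (@subsetT _ _)).
  exact: Ck_sub (@subIsetl _ V W) cV.
have h0 q : M q -> (V `&` W) q -> fs istar q - fhat q = 0.
  by move=> Mq [Vq Wq]; rewrite -fV // fW // subrr.
have := tangent_orth My Tz oVW (conj Vy Wy) cVW h0.
rewrite (gradB (@dfs istar y) (Ck_differentiable cV Vy)).
move: (grad (fs istar) y) (grad fhat y) orth => a b orth ab.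
by rewrite -(subrK b a) -addrA dotDl ab orth addr0.
Qed.

Lemma tangent_gradient_bound_equality : tangent_gradient_bound f M xbar.
Proof.
have [L L0 [[A B] [/= Ax Bx] AB]] := grad_lipschitz_family xbar fsC2.
have [W [oW Wx WP]] := equality_manifold_nbhs.
have [U nU leU] := near_local_equation.
have nW : nbhs xbar W by exact: open_nbhs_nbhs.
have fW p : M p -> W p -> f p = fs istar p.
  move=> Mp /WP[/nbhs_singleton pmax pact].
  by rewrite (on_manifold pmax pact Mp istarP).
(* The added 1 makes the constant positive even when [d = 0]. *)
exists (d%:R * L + 1); first by rewrite ltr_wpDl // mulr_ge0 // ltW.
exists (A `&` W, B `&` (U `&` W)).
  by split; [exact: filterI | apply: filterI => //; exact: filterI].
move=> [x y] /= [[Ax' /WP[xmax xact]] [By' [Uy Wy]]] My v xv.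
have [lam [lam0 lam1 lamN vE]] := clarke_max fsC1 xmax xv.
have [Tw] := orth_proj_tangent (v - covariant_grad f M y) leU Uy My.
set w := orth_proj _ _ in Tw * => /(_ w Tw) orth.
have covw := covariant_grad_orth leU Uy My oW Wy fW Tw.
pose D := \sum_i lam i *: (grad (fs i) x - grad (fs i) y).
(* Tested on the tangent vector [w], the covariant gradient, the gradient of [fs istar] at [y] and
   those of all pieces carrying weight agree. Only the gradient increments from [y] to [x] remain,
   and these are Lipschitz. *)
have wD : dot w w = dot D w.
  have -> : dot D w = dot v w - dot (grad (fs istar) y) w.
    rewrite vE; apply: dot_combinationB => // i lami.
    apply: tangent_grad_eq My _ Tw.
    by apply: xact; apply: contrapT => /lamN/eqP; exact/negP.
  move: orth covw; move: (covariant_grad f M y) (grad _ y) => a b.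
  by rewrite !dotBl => /subr0_eq <- /subr0_eq ->.
have Dle : `|D| <= L * `|x - y|.
  apply: le_trans (ler_norm_sum _ _ _) _.
  rewrite -[leRHS]mul1r -lam1 mulr_suml; apply: ler_sum => i _.
  rewrite normrZ ger0_norm // ler_wpM2l //.
  by rewrite distrC [`|x - y|]distrC; exact: (AB (x, y) (conj Ax' By') i).
have wle : enorm w <= enorm D.
  have [w0|w0] := eqVneq (enorm w) 0; first by rewrite w0 enorm_ge0.
  have wp : 0 < enorm w by rewrite lt_def w0 enorm_ge0.
  by rewrite -(ler_pM2r wp) -expr2 enorm_sqr wD dot_le_enorm.
apply: le_trans wle _; apply: le_trans (enorm_le_norm D) _.
apply: (@le_trans _ _ (d%:R * L * enorm (x - y))).
  rewrite -mulrA ler_wpM2l //; apply: le_trans Dle _.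
  by rewrite ler_wpM2l ?(ltW L0) // norm_le_enorm.
by rewrite ler_wpM2r ?enorm_ge0 // lerDl.
Qed.

(** A piece with nonzero weight in [v] equals [f] at [x] and is at most [f] at [y], so its quadratic
    lower Taylor bound passes to [f]; averaging over the weights gives the claim. *)
Lemma lower_expansion_max : lower_expansion f M xbar.
Proof.
have [K [[A B] [/= Ax Bx] AB]] := taylor_lower_family xbar fsC2.
exists (fun t => - K * t ^+ 2).
  rewrite (_ : (fun t => _) = (fun t => - K * t)); last first.
    (* At [t = 0] both sides are 0, since the inverse of 0 is 0 by convention. *)
    apply/funext => t; have [->|t0] := eqVneq t 0; first by rewrite invr0 !mulr0.
    by rewrite expr2 mulrA mulfK.
  rewrite -[X in _ --> X](mulr0 (- K)); apply: cvgMl_tmp.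
  exact: cvg_within.
have fmax' : \forall x \near xbar, \forall z \near x, is_max f fs z by exact/near_join.
exists (A `&` [set y | is_max f fs y], B `&` [set x | \forall z \near x, is_max f fs z]).
  by split; exact: filterI.
move=> [y x] /= [[Ay [yle _]] [Bx' xmax]] My v xv.
have [lam [lam0 lam1 lamN ->]] := clarke_max fsC1 xmax xv.
rewrite -lerBrDr -lerBrDl; apply: dot_combination_le => // i lami.
have ai : fs i x = f x by apply: contrapT => /lamN/eqP; exact/negP.
rewrite lerBrDl lerBrDr -ai mulNr.
exact: le_trans (AB (y, x) (conj Ay Bx') i) (yle i).
Qed.

End MaxFunction.

Theorem corollary3p4 (R : realType) (d : nat) (f : 'rV[R]_d -> R)
    (I : finType) (i0 : I) (fs : I -> 'rV[R]_d -> R) (xbar : 'rV[R]_d) :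
  locally_lipschitz f ->
  (forall i, Ck 4 setT (fs i)) ->
  local_minimizer f xbar ->
  affinely_independent (fun i => grad (fs i) xbar) ->
  (\forall x \near xbar, f x = \big[Num.max/fs i0 x]_(i : I) fs i x) ->
  relint (clarke f xbar) 0 ->
  (exists2 gamma : R, 0 < gamma & quadratic_growth gamma f xbar) ->
  typical f xbar.
Proof.
move=> flip fsC4 fmin indep fbig ri0 growth; split=> //.
have fmax : \forall x \near xbar, is_max f fs x.
  by apply: filterS fbig => x; exact: bigmax_is_max.
(* A piece attaining the maximum at [xbar] serves as reference in the equations of the manifold. *)
have [_ [istar istarP]] := nbhs_singleton fmax.
exists (equality_manifold f fs xbar istar); split.
- exact: active_equality_manifold.
- exact: tangent_gradient_bound_equality.
- exact: lower_expansion_max.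
Qed.
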